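(* Let $\lambda$ be a cardinal number. There exists a commutative ring $R$ with $|R^\times| = \lambda$ if and only if $\lambda$ is equal to one of the following: (1) an odd number of the form $\prod_{i=1}^t (2^{n_i} - 1)$ for some positive integers $n_1, \dots, n_t$; (2) a positive even number; or (3) an infinite cardinal number.
   Context: Rings have a multiplicative identity. For a commutative ring $R$, $R^\times$ denotes the group of units of $R$, and $|R^\times|$ denotes its cardinality. *)

(* Defs.v *)
From mathcomp Require Import all_boot all_algebra.
From mathcomp Require Import boolp classical_sets functions cardinality.

Set Implicit Arguments.
Unset Strict Implicit.
Unset Printing Implicit Defensive.

Local Open Scope classical_set_scope.
Local Open Scope ring_scope.

(* [comPzRingType] is the type of all commutative rings with identity, the zero
   ring included; [GRing.unit] is only available on nonzero rings, hence the
   explicit set of invertible elements. *)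
Definition unit_set (R : comPzRingType) : set R :=
  [set x : R | exists y : R, x * y = 1].
Arguments unit_set R : clear implicits.

(* Main.v *)
Require Import Defs.
From mathcomp Require Import all_boot all_algebra finfield finmap.
From mathcomp Require Import boolp classical_sets functions cardinality.
From HB Require Import structures.

(* If the unit group U is finite of odd order, then -1 = 1 and no unit squares
   to 1 except 1 itself. Hence the additive span S of U is a finite reduced
   ring of characteristic 2 with unit group U. An idempotent of S either splits
   into two smaller orthogonal idempotents, or cuts out a field; so U is a
   product of unit groups of fields of order 2^n.
   Conversely, products of finite fields realize the odd numbers. The trivial
   extension of the integers by an abelian group M has the units (+-1, x) with
   x in M, hence 2|M| of them: taking M cyclic gives the even numbers. For L
   infinite, Zorn's lemma gives a maximal injection into L of the finite subsets
   of some X included in L; by maximality the complement of its range is smaller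
   than the range, so the group M of finite subsets of X satisfies
   |M| <= |L| <= 2|M|, and 2|M| = |M| because X is infinite. *)

Set Implicit Arguments.
Unset Strict Implicit.
Unset Printing Implicit Defensive.
Import GRing.Theory.
Local Open Scope fset_scope.
Local Open Scope ring_scope.

(** * Counting finite products, and spans over the field with two elements *)

Lemma cardfsM (K K' : choiceType) (A : {fset K}) (B : {fset K'}) :
  #|` A `*` B| = (#|` A| * #|` B|)%N.
Proof.
pose s := [seq (x, y) | x <- A, y <- B].
have -> : A `*` B = [fset u in s].
  apply/fsetP => -[x y]; rewrite !inE /=.
  apply/andP/idP => [[xA yB]|]; first by apply/allpairsP; exists (x, y).
  by case/allpairsP => -[a b] [aA bB [-> ->]].
rewrite card_fseq undup_id ?size_allpairs //.
by apply: allpairs_uniq => // -[a b] [c d].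
Qed.

Section Char2Span.
Variable V : zmodType.
Hypothesis addxx : forall x : V, x + x = 0.

(** As x + x = 0, coefficients are 0 or 1, so a new generator adjoins only one translate of the
    previous span. *)
Fixpoint span2 (s : seq V) : {fset V} :=
  if s is x :: s' then span2 s' `|` [fset x + y | y in span2 s'] else [fset 0].

Lemma span2_consP x s y :
  reflect (y \in span2 s \/ x + y \in span2 s) (y \in span2 (x :: s)).
Proof.
have xK z : x + (x + z) = z by rewrite addrA addxx add0r.
rewrite /= in_fsetU; apply: (iffP orP) => -[ys|]; [by left| |by left|]; last first.
  by move=> xys; right; apply/imfsetP; exists (x + y).
by case/imfsetP => z /= zs ->; right; rewrite xK.
Qed.

Lemma span2_0 s : 0 \in span2 s.
Proof. by elim: s => [|x s IH]; [rewrite /= inE | rewrite /= in_fsetU IH]. Qed.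

Lemma span2_sub (T : {fset V}) (s : seq V) :
  0 \in T -> {in T &, forall x y, x + y \in T} -> {subset s <= T} ->
  {subset span2 s <= T}.
Proof.
move=> T0 TD; elim: s => [_ x /[!inE] /eqP-> //|x s IH sT].
have {}IH := IH (fun y ys => sT y (mem_behead (ys : y \in behead (x :: s)))).
have xT : x \in T by apply: sT; rewrite mem_head.
move=> y /span2_consP[/IH //|/IH yT].
by rewrite -[y]add0r -(addxx x) -addrA; apply: TD.
Qed.

Lemma sub_span2 s : {subset s <= span2 s}.
Proof.
elim: s => [//|x s IH] y /[1!inE] /predU1P[->|/IH ys]; apply/span2_consP.
  by right; rewrite addxx span2_0.
by left.
Qed.

Lemma span2D s : {in span2 s &, forall x y, x + y \in span2 s}.
Proof.
elim: s => [|x s IH] y z; first by rewrite !inE => /eqP-> /eqP->; rewrite addr0.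
move=> /span2_consP[ys|ys] /span2_consP[zs|zs]; apply/span2_consP.
- by left; apply: IH.
- by right; rewrite addrCA; apply: IH.
- by right; rewrite addrA; apply: IH.
- left; rewrite -[y + z]add0r -(addxx x) addrACA; exact: IH.
Qed.

(** The translate of the span by a new generator either coincides with the span or is disjoint from
    it, so the size stays or doubles. *)
Lemma card_span2 s : exists k, #|` span2 s| = (2 ^ k)%N.
Proof.
elim: s => [|x s [k IH]]; first by exists 0; rewrite /= cardfs1.
case: (boolP (x \in span2 s)) => xs.
  exists k; rewrite -IH; congr #|` _|; apply/fsetP => y.
  apply/span2_consP/idP => [[//|ys]|]; last by left.
  by rewrite -[y]add0r -(addxx x) -addrA; apply: span2D.
exists k.+1; rewrite /= cardfsU card_imfset; last exact: addrI.
rewrite IH (_ : _ `&` _ = fset0) ?cardfs0 ?subn0 ?expnS ?mul2n ?addnn //.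
apply/fsetP => y; rewrite in_fsetI in_fset0; apply/negP => /andP[ys].
case/imfsetP => z /= zs yE; case/negP: xs.
by rewrite -[x]addr0 -(addxx z) addrA -yE; apply: span2D.
Qed.

(** A closed set containing 0 is its own span. *)
Lemma card_addr_closed2 (T : {fset V}) :
  0 \in T -> {in T &, forall x y, x + y \in T} -> exists k, #|` T| = (2 ^ k)%N.
Proof.
move=> T0 TD; have [k kE] := card_span2 T; exists k; rewrite -kE; congr #|` _|.
by apply/fsetP => x; apply/idP/idP; [apply: sub_span2 | apply: span2_sub].
Qed.

End Char2Span.

(** * Mersenne products and units of finite reduced rings of characteristic 2 *)

Definition mersenne_prod (m : nat) :=
  exists2 s : seq nat, all (leq 1) s & m = (\prod_(i <- s) (2 ^ i - 1))%N.

Lemma mersenne_prodM m n :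
  mersenne_prod m -> mersenne_prod n -> mersenne_prod (m * n).
Proof.
move=> [s s0 ->] [t t0 ->]; exists (s ++ t); first by rewrite all_cat s0.
by rewrite big_cat.
Qed.

Section FiniteReduced.
Variable R : comPzRingType.
Hypothesis addxx : forall x : R, x + x = 0.
Variable S : {fset R}.
Hypothesis S0 : 0 \in S.
Hypothesis S1 : 1 \in S.
Hypothesis SD : {in S &, forall x y, x + y \in S}.
Hypothesis SM : {in S &, forall x y, x * y \in S}.
Hypothesis Sred : {in S, forall x, x * x = 0 -> x = 0}.

Lemma expr_closed x n : x \in S -> x ^+ n \in S.
Proof. by move=> xS; elim: n => [|n IH]; rewrite ?expr0 // exprS SM. Qed.

(** Since n < 2^n, the power x^(2^n) vanishes as well, and reducedness removes the n squarings one
    by one. *)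
Lemma expr_eq0_red x n : x \in S -> x ^+ n = 0 -> x = 0.
Proof.
move=> xS xn0; have : x ^+ (2 ^ n) = 0.
  by rewrite -(subnK (ltnW (ltn_expl n (ltnSn 1)))) exprD xn0 mulr0.
elim: n {xn0} => [|n IH]; first by rewrite expn0 expr1.
by rewrite expnSr exprM expr2 => /Sred H; apply/IH/H/expr_closed.
Qed.

(** By pigeonhole the powers of x repeat, with some period d from an exponent i on. *)
Lemma idempotent_expr x : x \in S ->
  exists2 n, (0 < n)%N & x ^+ n * x ^+ n = x ^+ n.
Proof.
move=> xS.
pose F (i : 'I_(#|` S|).+1) : S := [` expr_closed i xS].
have /injectivePn[i [j ij xij]] : ~~ injectiveb F.
  by apply/injectiveP => /leq_card; rewrite card_ord cardfE ltnn.
have {F}xij : x ^+ i = x ^+ j by move/(congr1 val): xij.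
have {ij} /orP ij : (i < j)%N || (j < i)%N by rewrite -neq_ltn.
wlog ltij : i j xij ij / (i < j)%N => [W|].
  case: ij => [ltij|ltji]; first exact: W xij (or_introl ltij) ltij.
  exact: W (esym xij) (or_introl ltji) ltji.
set d := (j - i)%N; have d0 : (0 < d)%N by rewrite subn_gt0.
have xd n : (i <= n)%N -> x ^+ (n + d) = x ^+ n.
  move=> le_in; rewrite -(subnK le_in) -addnA subnKC ?(ltnW ltij) //.
  by rewrite !exprD xij.
have xkd k n : (i <= n)%N -> x ^+ (n + k * d) = x ^+ n.
  move=> le_in; elim: k => [|k IHk]; first by rewrite mul0n addn0.
  by rewrite mulSn addnCA addnC xd // (leq_trans le_in (leq_addr _ _)).
(* This multiple of d is positive and at least i, so doubling the exponent is a shift by a multiple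
   of the period. *)
exists (i.+1 * d)%N; first by rewrite muln_gt0.
by rewrite -exprD xkd // (leq_trans (leqnSn i)) // leq_pmulr.
Qed.

(* [corner e] is the ring eS, whose identity is e. *)
Definition corner e := [fset x in S | e * x == x].
(** The inverse is sought in all of [S]: replacing y by e * y moves it into eS and leaves x * y
    unchanged. *)
Definition corner_unit e :=
  [fset x in corner e | [exists y : S, x * val y == e]].

Lemma cornerP e x : reflect (x \in S /\ e * x = x) (x \in corner e).
Proof. by rewrite !inE /=; apply: (iffP andP) => -[? /eqP]. Qed.

Lemma corner_unitP e x :
  reflect (x \in corner e /\ exists2 y, y \in S & x * y = e)
          (x \in corner_unit e).
Proof.
rewrite /corner_unit; move: (corner e) => C; rewrite !inE /=.
apply: (iffP andP) => -[? H]; split => //.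
  by case/existsP: H => y /eqP; exists (val y); rewrite ?fsvalP.
by case: H => y yS H; apply/existsP; exists [` yS]; apply/eqP.
Qed.

(** Orthogonality identifies (f + g)S with fS x gS: the map (a, b) -> a + b has inverse x -> (f x, g
    x). *)
Lemma card_corner_unitD f g : f \in S -> g \in S ->
    f * f = f -> g * g = g -> f * g = 0 ->
  #|` corner_unit (f + g)| = (#|` corner_unit f| * #|` corner_unit g|)%N.
Proof.
move=> fS gS ff gg fg; have gf : g * f = 0 by rewrite mulrC.
have fE x : f * x = x -> g * x = 0 by move=> <-; rewrite mulrA gf mul0r.
have gE x : g * x = x -> f * x = 0 by move=> <-; rewrite mulrA fg mul0r.
rewrite -cardfsM; set D := corner_unit f `*` corner_unit g.
have injD : {in D &, injective (fun a : R * R => a.1 + a.2)}.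
  move=> [a b] [c d] /=; rewrite !in_fsetM /= => /andP[].
  move=> /corner_unitP[/cornerP[_ fa] _] /corner_unitP[/cornerP[_ gb] _] /andP[].
  move=> /corner_unitP[/cornerP[_ fc] _] /corner_unitP[/cornerP[_ gd] _] E.
  congr pair.
    by move/(congr1 ( *%R f)): E; rewrite !mulrDr fa fc (gE b) // (gE d) // !addr0.
  by move/(congr1 ( *%R g)): E; rewrite !mulrDr gb gd (fE a) // (fE c) // !add0r.
rewrite -[RHS](card_in_imfset imfset_key injD).
congr #|` _|; apply/fsetP => x; apply/corner_unitP/imfsetP => /=.
  move=> [/cornerP[xS ex] [y yS xy]].
  exists (f * x, g * x); last by rewrite /= -mulrDl ex.
  rewrite in_fsetM /=; apply/andP; split; apply/corner_unitP; split.
  - by apply/cornerP; rewrite mulrA ff; split => //; apply: SM.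
  - by exists y; rewrite // -mulrA xy mulrDr ff fg addr0.
  - by apply/cornerP; rewrite mulrA gg; split => //; apply: SM.
  - by exists y; rewrite // -mulrA xy mulrDr gg gf add0r.
move=> [[a b]]; rewrite in_fsetM /= => /andP[].
move=> /corner_unitP[/cornerP[aS fa] [a' a'S aa']].
move=> /corner_unitP[/cornerP[bS gb] [b' b'S bb']] ->; split.
  apply/cornerP; split; first exact: SD.
  by rewrite mulrDl !mulrDr fa gb (gE b) // (fE a) // add0r addr0.
exists (f * a' + g * b'); first by apply: SD; apply: SM.
have af : a * f = a by rewrite mulrC.
have bg : b * g = b by rewrite mulrC.
have ag : a * g = 0 by rewrite mulrC fE.
have bf : b * f = 0 by rewrite mulrC gE.
by rewrite mulrDl !mulrDr !mulrA af ag bf bg !mul0r addr0 add0r aa' bb'.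
Qed.

Lemma mersenne_corner_unit e : e \in S -> e * e = e ->
  mersenne_prod #|` corner_unit e|.
Proof.
have [n] := ubnP #|` corner e|; elim: n e => // n IH e len eS ee.
have [-> | e0] := eqVneq e 0.
  (* In the zero ring 0 is invertible, so the count is the empty product 1. *)
  exists [::] => //; rewrite big_nil (_ : corner_unit 0 = [fset 0]) ?cardfs1 //.
  apply/fsetP => x; rewrite in_fset1; apply/corner_unitP/eqP.
    by case=> /cornerP[_]; rewrite mul0r.
  move=> ->; split; last by exists 0; rewrite // mul0r.
  by apply/cornerP; rewrite mul0r.
have [[f [fS ff ef f0 fe]]|prim] := pselect (exists f,
    [/\ f \in S, f * f = f, e * f = f, f != 0 & f != e]).
  (* In characteristic 2 the complementary idempotent e - f is e + f. *)
  have gS : e + f \in S by apply: SD.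
  have eg : e * (e + f) = e + f by rewrite mulrDr ee ef.
  have fg : f * (e + f) = 0 by rewrite mulrDr ff mulrC ef addxx.
  have gg : (e + f) * (e + f) = e + f by rewrite mulrDl eg fg addr0.
  have eE : e = f + (e + f) by rewrite addrCA addxx addr0.
  (* [corner h] lies in [corner e] and misses [e]. *)
  have ltc h : h \in S -> e * h = h -> h != e -> (#|` corner h| < n)%N.
    move=> hS eh he; apply: (leq_trans (fproper_ltn_card _) len).
    rewrite fproperEneq; apply/andP; split.
      apply: contra_neq he => ch; have : e \in corner h.
        by rewrite ch; apply/cornerP.
      by case/cornerP => _; rewrite mulrC eh.
    apply/fsubsetP => x /cornerP[xS hx]; apply/cornerP; split=> //.
    by rewrite -hx mulrA eh.
  rewrite eE card_corner_unitD //; apply: mersenne_prodM;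
    apply: IH => //; apply: ltc => //.
  apply: contra_neq f0 => H.
  by rewrite -[f]add0r -(addxx e) -addrA H addxx.
have [k kE] : exists k, #|` corner e| = (2 ^ k)%N.
  apply: card_addr_closed2 => //; first by apply/cornerP; rewrite mulr0.
  move=> x y /cornerP[xS ex] /cornerP[yS ey]; apply/cornerP.
  by rewrite mulrDr ex ey; split=> //; exact: SD.
have c0 : 0 \in corner e by apply/cornerP; rewrite mulr0.
have ce : e \in corner e by apply/cornerP.
have cE : corner_unit e = corner e `\ 0.
  apply/fsetP => x; rewrite in_fsetD1; apply/corner_unitP/andP.
    move=> [xe [y yS xy]]; split => //.
    by apply: contra_neq e0 => x0; rewrite -xy x0 mul0r.
  move=> [x0 xe]; split=> //; have /cornerP[xS ex] := xe.
  (* Some power x^(m+1) is idempotent and, [S] being reduced, nonzero; as [e] is primitive it equals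
     [e], so x^m inverts x. *)
  have [[//|m] _ xm] := idempotent_expr xS.
  exists (x ^+ m); first exact: expr_closed.
  rewrite -exprS; apply/eqP; apply: contraT => xme; case: prim.
  exists (x ^+ m.+1); split=> //; first exact: expr_closed.
    by rewrite exprS mulrA ex.
  by apply: contra_neq x0; apply: expr_eq0_red.
have := cardfsD1 0 (corner e); rewrite c0 -cE kE => kE'.
exists [:: k]; last by rewrite big_seq1 kE' add1n subn1.
(* With k = 0 only 0 would be left in eS, which contains the nonzero [e]. *)
rewrite /= andbT lt0n; apply: contraNneq e0 => k0.
move: kE'; rewrite k0 expn0 add1n => -[/esym/cardfs0_eq cu0].
by have := in_fset0 e; rewrite -cu0 cE in_fsetD1 ce andbT => /negbFE.
Qed.

End FiniteReduced.

(** * Rings with an odd number of units *)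

Lemma odd_card_involution (K : choiceType) (U : {fset K}) (f : K -> K) :
    {in U, forall x, f x \in U} -> {in U, forall x, f (f x) = x} ->
    {in U, forall x, f x != x} ->
  ~~ odd #|` U|.
Proof.
elim: {U}_.+1 {-2}U (ltnSn #|` U|) => // n IH U ltU fU ff fx.
have [->|[x xU]] := fset_0Vmem U; first by rewrite cardfs0.
have fxU := fU x xU.
have fxx : f x \in U `\ x by rewrite in_fsetD1 fx ?fU.
have := cardfsD1 x U; rewrite xU (cardfsD1 (f x) (U `\ x)) fxx /= => UE.
(* Remove the two-element orbit {x, f x}. *)
rewrite UE /= negbK; apply: IH.
- by move: ltU; rewrite UE ltnS => /ltnW.
- move=> y; rewrite !in_fsetD1 => /and3P[yfx yx yU]; rewrite fU // andbT.
  apply/andP; split; first by apply: contra_neq yx => /(congr1 f); rewrite !ff.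
  by apply: contra_neq yfx => <-; rewrite ff.
- by move=> y; rewrite !in_fsetD1 => /and3P[_ _]; apply: ff.
- by move=> y; rewrite !in_fsetD1 => /and3P[_ _]; apply: fx.
Qed.

Lemma mersenne_odd_units (R : comPzRingType) (m : nat) :
  (unit_set R #= `I_m)%card -> odd m -> mersenne_prod m.
Proof.
move=> Rm odd_m; have finU : finite_set (unit_set R) by exists m.
pose U := fset_set (unit_set R).
have UP x : reflect (exists y, x * y = 1) (x \in U).
  by rewrite in_fset_set //; apply: (iffP idP) => [/set_mem|/mem_set].
have cardU : #|` U| = m by apply: card_fset_set.
have UM : {in U &, forall x y, x * y \in U}.
  move=> x y /UP[x' xx'] /UP[y' yy']; apply/UP; exists (x' * y').
  by rewrite mulrACA xx' yy' mulr1.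
have U1 : 1 \in U by apply/UP; exists 1; rewrite mulr1.
have sqr1 (x : R) : x * x = 1 -> x = 1.
  move=> xx; apply/eqP/negPn/negP => x1; move: odd_m; rewrite -cardU.
  (* Multiplication by x would be a fixed-point-free involution of the units. *)
  apply/negP; apply: (@odd_card_involution _ _ ( *%R x)) => y yU.
  - by apply: UM => //; apply/UP; exists x.
  - by rewrite mulrA xx mul1r.
  - apply: contra_neq x1 => xyy; have /UP[y' yy'] := yU.
    by rewrite -[x]mulr1 -yy' mulrA xyy.
have addxx (x : R) : x + x = 0.
  have N1 : -1 = 1 :> R by apply: sqr1; rewrite mulrNN mulr1.
  by rewrite -{2}[x]mul1r -N1 mulN1r subrr.
(* The span of the units is closed under products, first by a unit and then by any element. *)
pose S := span2 U; have US : {subset U <= S} by apply: sub_span2.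
have S0 : 0 \in S := span2_0 U.
have SD : {in S &, forall x y, x + y \in S} by apply: span2D.
have SM1 u x : u \in U -> x \in S -> u * x \in S.
  move=> uU; have /UP[v uv] := uU.
  (* [T] is the preimage of [S] under multiplication by u, written as an image to be visibly finite;
     it is additively closed and contains the units, hence [S]. *)
  pose T := [fset v * y | y in S].
  have TP y : (y \in T) = (u * y \in S).
    apply/imfsetP/idP => [[z /= zS ->]|uyS]; first by rewrite mulrA uv mul1r.
    by exists (u * y); rewrite // mulrA (mulrC v) uv mul1r.
  move=> xS; rewrite -TP; apply: (span2_sub addxx _ _ _ xS).
  - by rewrite TP mulr0.
  - by move=> y z; rewrite !TP mulrDr; apply: SD.
  - by move=> y yU; rewrite TP; apply/US/UM.
have SM : {in S &, forall x y, x * y \in S}.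
  move=> x y xS yS; pose T := [fset z in S | z * y \in S].
  have TP z : (z \in T) = (z \in S) && (z * y \in S) by rewrite !inE.
  suff : x \in T by rewrite TP => /andP[].
  apply: (span2_sub addxx _ _ _ xS).
  - by rewrite TP mul0r S0.
  - move=> a b; rewrite !TP => /andP[aS ay] /andP[bS by_].
    by rewrite mulrDl !SD.
  - by move=> z zU; rewrite TP US // SM1.
have Sred : {in S, forall x, x * x = 0 -> x = 0}.
  (* In characteristic 2, (1 + x)^2 = 1 + x^2 = 1, so 1 + x = 1. *)
  move=> x _ xx; have /sqr1 : (1 + x) * (1 + x) = 1.
    by rewrite mulrDl mul1r mulrDr mulr1 xx addr0 -addrA addxx addr0.
  by move/(congr1 (+%R (-1))); rewrite addrA addNr add0r.
rewrite -cardU (_ : U = corner_unit S 1).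
  by apply: mersenne_corner_unit => //; [apply: US|apply: US|rewrite mulr1].
apply/fsetP => x; apply/UP/corner_unitP => [[y xy]|[_ [y _ xy]]]; last by exists y.
split; first by apply/cornerP; rewrite mul1r; split=> //; apply/US/UP; exists y.
by exists y => //; apply/US/UP; exists x; rewrite mulrC.
Qed.

(** * Realizing finite cardinals by products of fields *)

Definition realizable T (A : set T) :=
  exists R : comPzRingType, (unit_set R #= A)%card.

Lemma card_II_X (T U : choiceType) (A : set T) (B : set U) m n :
  (A #= `I_m -> B #= `I_n -> (A `*` B)%classic #= `I_(m * n))%card.
Proof.
move=> Am Bn; have fA : finite_set A by exists m.
have fB : finite_set B by exists n.
rewrite -(fset_setK (finite_setX fA fB)); apply/card_eq_fsetP.
by rewrite fset_setX // cardfsM (card_fset_set Am) (card_fset_set Bn).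
Qed.

Lemma card_finpred (T : finType) (P : pred T) : ([set` P]%classic #= `I_#|P|)%card.
Proof.
rewrite (_ : [set` P] = [set` [fset x in P]])%classic.
  by apply/card_eq_fsetP; rewrite card_finset.
by apply/seteqP; split=> x /=; rewrite !inE.
Qed.

Lemma realizableM m n :
  realizable `I_m -> realizable `I_n -> realizable `I_(m * n).
Proof.
move=> [R Rm] [S Sn]; exists (R * S)%type.
rewrite (_ : unit_set _ = (unit_set R `*` unit_set S)%classic).
  exact: card_II_X.
apply/seteqP; split=> [[x y] [[x' y'] [xx yy]]|[x y] [[x' xx] [y' yy]]] /=.
  by split; [exists x' | exists y'].
by exists (x', y'); congr pair.
Qed.

Lemma realizable_mersenne k : (0 < k)%N -> realizable `I_(2 ^ k - 1).
Proof.
move=> k0; have [F charF cardF] := PrimePowerField (isT : prime 2) k0.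
exists F; rewrite -cardF subn1 -(cardC1 (0 : F)).
rewrite (_ : unit_set F = [set` predC1 (0 : F)]%classic); first exact: card_finpred.
apply/seteqP; split=> x /=.
  move=> [y xy]; apply: contraTneq (oner_neq0 F) => x0.
  by rewrite -xy x0 mul0r eqxx.
by move=> x0; exists x^-1; rewrite divff.
Qed.

Lemma realizable_mersenne_prod m : mersenne_prod m -> realizable `I_m.
Proof.
move=> [s s0 ->]; elim: s s0 => [_|k s IH /= /andP[k0 s0]].
  (* The empty product is 1 = 2^1 - 1, realized by the field with two elements. *)
  rewrite big_nil; exact: (@realizable_mersenne 1).
by rewrite big_cons; apply: realizableM; [apply: realizable_mersenne|apply: IH].
Qed.

(** * Trivial extensions of the integers *)

Section TrivialExtension.
Variable M : zmodType.

(* An alias, since [int * M] may carry the componentwise ring structure. *)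
Definition trivext : Type := (int * M)%type.
HB.instance Definition _ := GRing.Zmodule.on trivext.

Definition trivext_mul (x y : trivext) : trivext :=
  (x.1 * y.1, y.2 *~ x.1 + x.2 *~ y.1).
Definition trivext_one : trivext := (1, 0).

Lemma trivext_mulA : associative trivext_mul.
Proof.
move=> [a x] [b y] [c z]; rewrite /trivext_mul /= mulrA; congr pair.
by rewrite !mulrzDl -!mulrzA addrA (mulrC b a) (mulrC b c) (mulrC a c).
Qed.
Lemma trivext_mulC : commutative trivext_mul.
Proof. by move=> [a x] [b y]; rewrite /trivext_mul /= mulrC addrC. Qed.
Lemma trivext_mul1 : left_id trivext_one trivext_mul.
Proof. by move=> [a x]; rewrite /trivext_mul /= mul1r mulr1z mul0rz addr0. Qed.
Lemma trivext_mulDl : left_distributive trivext_mul +%R.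
Proof.
move=> [a x] [b y] [c z]; rewrite /trivext_mul /=; congr pair => /=.
  by rewrite mulrDl.
by rewrite mulrzDr mulrzDl addrACA.
Qed.
HB.instance Definition _ := GRing.Zmodule_isComPzRing.Build trivext
  trivext_mulA trivext_mulC trivext_mul1 trivext_mulDl.

(** The first coordinate of a unit is a unit of the integers, so a sign, coded by the boolean; over
    each sign s every x occurs, since (s, -x) inverts (s, x). *)
Lemma card_unit_trivext : (unit_set trivext #= [set: bool * M]%classic)%card.
Proof.
pose f (u : bool * M) : trivext := ((-1) ^+ u.1, u.2).
have f_inj : injective f.
  move=> [a x] [b y] [/(congr1 (fun z : int => z == 1)) ab ->].
  by case: a b ab => -[].
rewrite (_ : unit_set _ = f @` [set: bool * M])%classic.
  by apply: inj_card_eq => u v _ _; apply: f_inj.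
apply/seteqP; split=> [[a x] [[b y] [ab _]]|_ [[s x] _ <-]].
  have /intUnitRing.unitzPl : b * a = 1 by rewrite mulrC.
  by rewrite qualifE /= => /orP[]/eqP->; [exists (false, x)|exists (true, x)].
exists ((-1) ^+ s, - x); congr pair => /=.
  by case: s.
by rewrite mulNrz addNr.
Qed.

End TrivialExtension.

Lemma realizable_double m : (0 < m)%N -> realizable `I_(m.*2).
Proof.
(* ['I_m.+1] is the cyclic group of order m + 1. *)
case: m => // m _; exists (trivext 'I_m.+1).
apply: card_eq_trans (card_unit_trivext _) _.
rewrite -[X in X.*2]card_ord -mul2n -card_bool -card_prod.
rewrite -(_ : [set` predT] = [set: bool * 'I_m.+1])%classic ?card_finpred //.
by apply/seteqP.
Qed.

(** * The group of finite subsets of a set *)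

Section SymmetricDifference.
Variable K : choiceType.

(** An alias to carry the group law: under symmetric difference the finite subsets form the vector
    space over the field with two elements with basis [K]. *)
Definition fset_symdiff : Type := {fset K}.
HB.instance Definition _ := Choice.on fset_symdiff.

Definition symdiff (A B : fset_symdiff) : fset_symdiff := (A `\` B) `|` (B `\` A).

Lemma in_symdiff A B x : (x \in symdiff A B) = (x \in A) (+) (x \in B).
Proof. by rewrite !inE /=; case: (x \in A); case: (x \in B). Qed.

Lemma symdiffA : associative symdiff.
Proof. by move=> A B C; apply/fsetP => x; rewrite !in_symdiff addbA. Qed.
Lemma symdiffC : commutative symdiff.
Proof. by move=> A B; apply/fsetP => x; rewrite !in_symdiff addbC. Qed.
Lemma symdiff0 : left_id (fset0 : fset_symdiff) symdiff.
Proof. by move=> A; apply/fsetP => x; rewrite in_symdiff in_fset0. Qed.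
Lemma symdiffxx : left_inverse (fset0 : fset_symdiff) id symdiff.
Proof. by move=> A; apply/fsetP => x; rewrite in_symdiff in_fset0 addbb. Qed.
HB.instance Definition _ := GRing.isZmodule.Build fset_symdiff
  symdiffA symdiffC symdiff0 symdiffxx.
End SymmetricDifference.

(** * Comparison of infinite cardinals *)

Section InfiniteCardinals.
Local Open Scope classical_set_scope.
Local Open Scope card_scope.

(** Partial injections are encoded as graphs, so that Zorn's lemma applies to unions of chains of
    sets. *)
Definition partial_inj T U (G : set (T * U)) :=
  (forall x y y', G (x, y) -> G (x, y') -> y = y') /\
  (forall x x' y, G (x, y) -> G (x', y) -> x = x').

(** Both projections are injective on G. *)
Lemma partial_inj_card T U (G : set (T * U)) :
  partial_inj G -> fst @` G #= snd @` G.
Proof.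
move=> [Gf Gi]; apply: (@card_eq_trans _ _ _ _ G).
  apply: inj_card_eq => -[x y] [x' y'] /set_mem Gxy /set_mem Gxy' /= xx'.
  by rewrite -xx' in Gxy' *; rewrite (Gf _ _ _ Gxy Gxy').
rewrite card_eq_sym; apply: inj_card_eq => -[x y] [x' y'].
move=> /set_mem Gxy /set_mem Gxy' /= yy'.
by rewrite -yy' in Gxy' *; rewrite (Gi _ _ _ Gxy Gxy').
Qed.

Lemma total_on_bigcup2 T (F : set (set T)) (x y : T) : total_on F subset ->
    (\bigcup_(G in F) G) x -> (\bigcup_(G in F) G) y ->
  exists2 G, F G & G x /\ G y.
Proof.
move=> Ftot [G FG Gx] [H FH Hy].
by have [GH|HG] := Ftot _ _ FG FH; [exists H|exists G] => //; split => //;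
  [apply: GH|apply: HG].
Qed.

Lemma partial_inj_bigcup T U (F : set (set (T * U))) :
    F `<=` @partial_inj T U -> total_on F subset ->
  partial_inj (\bigcup_(G in F) G).
Proof.
move=> FP Ftot; split=> [x y y'|x x' y] Gxy Gxy';
  have [G /FP[Gf Gi] [Gx Gy]] := total_on_bigcup2 Ftot Gxy Gxy'.
  exact: Gf Gx Gy.
exact: Gi Gx Gy.
Qed.

(** Take a maximal partial injection from A to B: if it missed both some x in A and some y in B, the
    pair (x, y) could be adjoined. *)
Lemma card_le_total T U (A : set T) (B : set U) : A #<= B \/ B #<= A.
Proof.
pose P (G : set (T * U)) := partial_inj G /\ G `<=` A `*` B.
have [F FP Ftot|G [[Gpi GAB] Gmax]] := @Zorn_bigcup _ P.
  split; first by apply: partial_inj_bigcup => // G /FP[].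
  by apply: bigcup_sub => G /FP[].
have [Gf Gi] := Gpi.
have dA : fst @` G `<=` A by move=> _ [[x y] /GAB[] ? ? <-].
have rB : snd @` G `<=` B by move=> _ [[x y] /GAB[] ? ? <-].
have GE := partial_inj_card Gpi.
have [dE|/existsNP[x /not_implyP[Ax ndx]]] := pselect (A `<=` fst @` G).
  left; rewrite (_ : A = fst @` G); last exact/seteqP.
  by rewrite (card_le_eql GE); apply: subset_card_le.
have [rE|/existsNP[y /not_implyP[By nry]]] := pselect (B `<=` snd @` G).
  right; rewrite (_ : B = snd @` G); last exact/seteqP.
  by rewrite -(card_le_eql GE); apply: subset_card_le.
have ndx' z : ~ G (x, z) by move=> Gxz; apply: ndx; exists (x, z).
have nry' z : ~ G (z, y) by move=> Gzy; apply: nry; exists (z, y).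
exfalso; apply: (Gmax (G `|` [set (x, y)])).
  split; first exact: subsetUl.
  by move=> /(_ (x, y)) H; apply: (ndx' y); apply: H; right.
split; last first.
  by rewrite subUset; split => // _ ->.
split=> [a b c|a b c] [Gab|[-> ->]] [Gac|[]].
- exact: Gf Gab Gac.
- by move=> ax; case: (ndx' b); rewrite -ax.
- by case: (ndx' c).
- by move=> ->.
- exact: Gi Gab Gac.
- by move=> _ cy; case: (nry' a); rewrite -cy.
- by case: (nry' b).
- by move=> -> .
Qed.

Lemma inj_card_leT T U (h : T -> U) : injective h -> [set: T] #<= [set: U].
Proof.
move=> h_inj; apply: card_le_trans (subset_card_le (@subsetT _ (range h))).
by rewrite -(card_le_eqr (card_esym (inj_card_eq (in2W h_inj)))).
Qed.

(** The boolean records on which side of A an element lies. *)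
Lemma card_le_bool_prod T U (A : set T) :
  A #<= [set: U] -> ~` A #<= [set: U] -> [set: T] #<= [set: bool * U].
Proof.
move=> /card_leP[f] /card_leP[g].
pose h x : bool * U := match pselect (A x) with
  | left Ax => (true, val (f (SigSub (mem_set Ax))))
  | right nAx => (false, val (g (SigSub (mem_set (nAx : (~` A) x))))) end.
apply: (inj_card_leT (h := h)).
move=> x y; rewrite /h.
by case: pselect => Ax; case: pselect => Ay // [] /val_inj/inj =>
  /(_ (mem_set I) (mem_set I)) /(congr1 val).
Qed.




(** Hilbert's hotel: shift a copy s of the naturals inside T by one and fix everything else; s 0 is
    then missed. *)
Lemma infinite_shift T : infinite_set [set: T] ->
  exists (g : T -> T) (t : T), injective g /\ forall x, g x <> t.
Proof.
move=> /infiniteP/card_leP[f].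
pose s n := val (f (SigSub (mem_set (I : [set: nat] n)))).
have s_inj m n : s m = s n -> m = n.
  by move=> /val_inj/inj => /(_ (mem_set I) (mem_set I)) /(congr1 val).
pose g x :=
  if pselect (exists n, x = s n) is left e then s (projT1 (cid e)).+1 else x.
have gP x : (exists2 n, x = s n & g x = s n.+1) \/
            (forall n, x <> s n) /\ g x = x.
  rewrite /g; case: pselect => [e|xs]; last first.
    by right; split=> // n xn; apply: xs; exists n.
  by left; exists (projT1 (cid e)) => //; case: cid => n /=.
exists g, (s 0); split=> [x y|x]; last first.
  by have [[n _ ->]|[xs ->]] := gP x => // /s_inj.
have [[n -> ->]|[xs ->]] := gP x; have [[m -> ->]|[ys ->]] := gP y => //.
- by move=> /s_inj [->].
- by move/esym/ys.
- by move/xs.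
Qed.

(* An injection g of K that misses t leaves t free to encode the boolean. *)
Lemma card_bool_fset (K : choiceType) : infinite_set [set: K] ->
  [set: bool * {fset K}] #<= [set: {fset K}].
Proof.
move=> /infinite_shift[g [t [g_inj gt]]].
pose h (u : bool * {fset K}) : {fset K} :=
  let T := [fset g x | x in u.2]%fset in if u.1 then (t |` T)%fset else T.
have tg (S : {fset K}) : t \notin [fset g x | x in S]%fset.
  by apply/imfsetP => -[x _ /esym/gt].
have gK (S S' : {fset K}) :
    [fset g x | x in S]%fset = [fset g x | x in S']%fset -> S = S'.
  move=> /fsetP SS'; apply/fsetP => x; have := SS' (g x).
  by rewrite !mem_imfset.
have th u : (t \in h u) = u.1.
  by rewrite /h; case: u.1; [rewrite fset1U1 | apply/negbTE].
have h_inj : injective h.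
  move=> [b S] [b' S'] E; have := th (b, S); rewrite E th /= => bb; subst b'.
  congr pair; move: E; rewrite /h /=; case: b => /= [|/gK//].
  by move=> /(congr1 (fun A => A `\ t)%fset); rewrite !fsetU1K // => /gK.
exact: (inj_card_leT h_inj).
Qed.

(** * A maximal injection on finite subsets *)

Section MaximalGraph.
Variable K : choiceType.
Hypothesis infK : infinite_set [set: K].

Definition gdom T U (G : set (T * U)) x := exists y, G (x, y).

(** Once it contains [fset0], such a D consists of all finite subsets of the set of x with {x} in D.
    Stated this way, X may vary in the Zorn argument while all graphs live on one type. *)
Definition union_ideal (D : set {fset K}) :=
  (forall S S', D S -> D S' -> D (S `|` S')%fset) /\
  (forall S S', (S `<=` S')%fset -> D S' -> D S).

(* If x is outside the support of G and f injects the range A of G into its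
   complement, then G extends by sending x |` S to f (G S). *)
Lemma ex_maximal_fset_graph : exists G : set ({fset K} * K),
  [/\ partial_inj G, union_ideal (gdom G), gdom G fset0 &
      forall x, snd @` G #<= ~` (snd @` G) -> gdom G [fset x]%fset].
Proof.
pose P (G : set ({fset K} * K)) := partial_inj G /\ union_ideal (gdom G).
have [F FP Ftot|G [[[Gf Gi] [GU Gs]] Gmax]] := @Zorn_bigcup _ P.
  split; first by apply: partial_inj_bigcup => // G /FP[].
  split=> [S S' [y Gy] [z Gz]|S S' SS' [y [G FG Gy]]].
    have [G FG [GSy GSz]] := total_on_bigcup2 Ftot Gy Gz.
    have [_ [GU _]] := FP _ FG.
    have [||w Gw] := GU S S'; [by exists y|by exists z|].
    by exists w, G.
  have [_ [_ Gs]] := FP _ FG; have [|w Gw] := Gs _ _ SS'; first by exists y.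
  by exists w, G.
(* The empty graph satisfies [P], as the empty chain requires, but it is not maximal: the single
   pair ([fset0], [k]) extends it. *)
have G0 : gdom G fset0.
  have [//|nG0] := pselect (gdom G fset0).
  have Ge S : ~ gdom G S by move=> /(Gs _ _ (fsub0set S)).
  have [k _] := infinite_setN0 infK.
  have Ge' u : ~ G u by case: u => S y GSy; apply: (Ge S); exists y.
  exfalso; apply: (Gmax [set (fset0, k)]).
    by split=> [u /Ge'//|/(_ (fset0, k) erefl)/Ge'].
  split; first by split=> [? ? ?|? ? ?] [-> ->] [->].
  split=> [S S' [y [-> _]] [z [-> _]]|S S' SS' [y [S'0 _]]].
    by rewrite fsetU0; exists k.
  by exists k; move: SS'; rewrite S'0 fsubset0 => /eqP->.
exists G; split=> // x /card_leP[f].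
have [//|nGx] := pselect (gdom G [fset x]%fset); exfalso.
set A := snd @` G in f.
have xdom S : gdom G S -> x \notin S.
  move=> GS; apply/negP => xS; apply: nGx; apply: Gs GS.
  by rewrite fsub1set.
have AG S y : G (S, y) -> A y by move=> ?; exists (S, y).
pose G' := G `|` [set u | exists S (a : A), [/\ G (S, val a),
   u.1 = (x |` S)%fset & u.2 = val (f a)]].
have fA (a : A) : ~ A (val (f a)) by apply: (set_valP (f a)).
(* The ideal conditions carry over to [G'] because its domain is described by removing x and testing
   in the old domain. *)
have domG' S : gdom G' S <-> gdom G (S `\ x)%fset.
  split=> [[y [GSy|[S0 [a [/= Ga -> _]]]]]|[y Gy]].
  - by apply: (Gs _ _ (fsubD1set S x)); exists y.
  - have GS0 : gdom G S0 by exists (val a).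
    by rewrite fsetU1K // xdom.
  have [xS|xS] := boolP (x \in S); last first.
    by exists y; left; rewrite mem_fsetD1 in Gy.
  exists (val (f (SigSub (mem_set (AG _ _ Gy))))); right.
  exists (S `\ x)%fset, (SigSub (mem_set (AG _ _ Gy))); split=> //=.
  by rewrite fsetD1K.
apply: (Gmax G').
  split; first exact: subsetUl.
  move=> G'G; apply: nGx; have [|y G'y] := (domG' [fset x]%fset).2.
    by rewrite fsetDv.
  by exists y; apply: G'G.
split.
  (* Old and new sets differ in containing x, old and new values in lying in [A], so the two parts
     of [G'] cannot clash. *)
  split=> [S y y'|S S' y].
    move=> [Gy|[S0 [a [/= Ga SE ->]]]] [Gy'|[S1 [a' [/= Ga' SE' ->]]]].
    - exact: Gf Gy Gy'.
    - by have /xdom := ex_intro _ y Gy : gdom G S; rewrite SE' fset1U1.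
    - by have /xdom := ex_intro _ y' Gy' : gdom G S; rewrite SE fset1U1.
    have xS0 : x \notin S0 by apply: xdom; exists (val a).
    have xS1 : x \notin S1 by apply: xdom; exists (val a').
    have S01 : S0 = S1 by rewrite -(fsetU1K xS0) -SE SE' fsetU1K.
    suff -> : a = a' by [].
    by rewrite S01 in Ga; exact/val_inj/(Gf _ _ _ Ga Ga').
  move=> [Gy|[S0 [a [/= Ga -> yE]]]] [Gy'|[S1 [a' [/= Ga' -> yE']]]].
  - exact: Gi Gy Gy'.
  - by move: (AG _ _ Gy); rewrite yE' => /(fA a').
  - by move: (AG _ _ Gy'); rewrite yE => /(fA a).
  have aa' : a = a'.
    move: yE; rewrite yE' => /val_inj/inj E.
    by apply/esym/E; apply: mem_set.
  by congr (x |` _)%fset; apply: (Gi _ _ (val a)) => //; rewrite aa'.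
split=> [S S' /domG' GS /domG' GS'|S S' SS' /domG' GS'].
  by apply/domG'; rewrite fsetDUl; apply: GU.
by apply/domG'; apply: Gs GS'; apply: fsetSD.
Qed.

(** [X] is the support of a maximal graph; its range is equinumerous with [{fset X}], so the point
    is to bound the complement of the range. *)
Lemma ex_card_bool_fset_eq :
  exists X : set K, [set: bool * {fset X}] #= [set: K].
Proof.
have [G [Gpi [GU Gs] G0 Gmax]] := ex_maximal_fset_graph.
pose X : set K := [set x | gdom G [fset x]%fset].
exists X.
have domP S : gdom G S <-> (forall x, x \in S -> X x).
  split=> [GS x xS|]; first by apply: Gs GS; rewrite fsub1set.
  suff H (s : seq K) : {in s, forall x, X x} -> gdom G [fset x in s]%fset.
    by move=> /H; congr (gdom G); apply/fsetP => x; rewrite !inE.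
  elim: s => [_|x s IH sX].
    by apply: Gs G0; apply/fsubsetP => y; rewrite !inE.
  rewrite fset_cons; apply: GU; first by apply: sX; rewrite !inE eqxx.
  by apply: IH => y ys; apply: sX; rewrite inE ys orbT.
pose F (S : {fset X}) : {fset K} := [fset val x | x in S]%fset.
have F_inj : injective F.
  move=> S S' /fsetP SS'; apply/fsetP => x; have := SS' (val x).
  by rewrite !mem_imfset //; apply: val_inj.
have rF : range F = gdom G.
  apply/seteqP; split=> [_ [S _ <-]|S /domP SX].
    by apply/domP => _ /imfsetP[x _ ->]; apply: set_valP.
  exists [fset x | x in pmap (insub : K -> option X) S]%fset => //.
  apply/fsetP => x; apply/imfsetP/idP => [[y /=]|xS].
    rewrite !inE mem_pmap => /mapP[z zS].
    by case: insubP => // u _ uz [->] ->; rewrite uz.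
  exists (SigSub (mem_set (SX x xS))) => //=.
  rewrite !inE mem_pmap; apply/mapP; exists x => //.
  by rewrite (insubT (fun y => y \in X) (mem_set (SX x xS)));
  congr Some; apply: val_inj.
have dG : gdom G = fst @` G.
  apply/seteqP; split=> [S [y Gy]|S [[S' y] Gy /= <-]]; last by exists y.
  by exists (S, y).
have cF : [set: {fset X}] #= snd @` G.
  rewrite -(card_eqr (partial_inj_card Gpi)) -dG -rF card_eq_sym.
  by apply: inj_card_eq => ? ? _ _; apply: F_inj.
have finC : finite_set (snd @` G) -> ~ finite_set (~` (snd @` G)).
  by move=> fA fcA; apply: infK; rewrite -(setUv (snd @` G)) finite_setU.
(* If [X] were finite, so would be the range; its complement would be infinite, hence larger, and
   maximality would make [X] all of [K]. *)
have infX : infinite_set X.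
  move=> finX; have finA : finite_set (snd @` G).
    rewrite -(eq_finite_set (partial_inj_card Gpi)) -dG.
    apply: (@sub_finite_set _ _ [set` fpowerset (fset_set X)]);
      last exact: finite_fset.
    move=> S /domP SX /=; rewrite fpowersetE; apply/fsubsetP => x /SX Xx.
    by rewrite in_fset_set // mem_set.
  apply: infK; rewrite (_ : [set: K] = X) //; apply/seteqP; split => // x _.
  apply: Gmax; have [//|/card_le_finite] := card_le_total (snd @` G) (~` (snd @` G)).
  by move=> /(_ finA)/(finC finA).
apply: Cantor_Bernstein.
  apply: card_le_trans (card_bool_fset _) _.
    by rewrite (eq_finite_set (card_setT X)).
  by rewrite (card_le_eql cF) card_leT.
apply: (@card_le_bool_prod _ _ (snd @` G)).
  by rewrite (card_le_eqr cF) card_lexx.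
(* If the complement is at least as large as the range, maximality puts every x in [X], and
   singletons embed [K] into [{fset X}]. *)
have [AA|] := card_le_total (snd @` G) (~` (snd @` G)).
  have XT x : x \in X by apply/mem_set/Gmax.
  apply: card_le_trans (card_leT _) _.
  apply: (inj_card_leT (h := fun x => [fset SigSub (XT x)]%fset)).
  by move=> x y /fset1_inj/(congr1 val).
by rewrite -(card_le_eqr cF).
Qed.
End MaximalGraph.

Lemma realizable_infinite (L : Type) :
  infinite_set [set: L] -> realizable [set: L].
Proof.
move=> infL; have [X XL] := @ex_card_bool_fset_eq {classic L} infL.
exists (trivext (fset_symdiff X)).
exact: (@card_eq_trans _ _ _ _ _ _ (card_unit_trivext (fset_symdiff X)) XL).
Qed.

End InfiniteCardinals.

Local Close Scope ring_scope.
Local Close Scope fset_scope.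
Local Open Scope classical_set_scope.
Local Open Scope card_scope.

(* The cardinal is the cardinality of an arbitrary type L. *)
Theorem theorem8 (L : Type) :
  (exists R : comPzRingType, unit_set R #= [set: L]) <->
  [\/ exists (t : nat) (n : 'I_t -> nat),
        [/\ forall i : 'I_t, 0 < n i,
            odd (\prod_(i < t) (2 ^ n i - 1)) &
            [set: L] #= `I_(\prod_(i < t) (2 ^ n i - 1))],
      exists m : nat, [/\ 0 < m, ~~ odd m & [set: L] #= `I_m] |
      infinite_set [set: L]].
Proof.
split=> [[R RL]|[[t [n [n0 _ Ln]]]|[m [m0 even_m Lm]]|infL]]; last first.
- exact: realizable_infinite.
- have [|R Rm] := @realizable_double m./2.
    by rewrite half_gt0; case: m m0 even_m {Lm} => [|[]].
  exists R; apply: card_eq_trans Rm _.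
  by rewrite even_halfK // card_eq_sym.
- have [|R Rm] := @realizable_mersenne_prod (\prod_(i < t) (2 ^ n i - 1)).
    exists [seq n i | i <- enum 'I_t]; first by apply/allP => _ /mapP[i _ ->].
    by rewrite big_map big_enum.
  by exists R; apply: card_eq_trans Rm _; rewrite card_eq_sym.
have [[m Lm]|] := pselect (finite_set [set: L]); last by constructor 3.
have Rm : unit_set R #= `I_m := card_eq_trans RL Lm.
have [odd_m|even_m] := boolP (odd m); last first.
  (* The cardinal is not 0 because 1 is always a unit. *)
  constructor 2; exists m; split=> //; rewrite lt0n; apply: contraPneq Rm => ->.
  rewrite II0 card_eq0 => /eqP/seteqP[+ _] => /(_ 1%R); apply.
  by exists 1%R; rewrite mulr1.
have [s s0 mE] := mersenne_odd_units Rm odd_m.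
constructor 1; exists (size s), (tnth (in_tuple s)).
have <- : m = \prod_(i < size s) (2 ^ tnth (in_tuple s) i - 1).
  by rewrite mE big_tnth.
by split=> // i; apply: (allP s0); rewrite mem_tnth.
Qed.
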